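(* Let $q$ be a prime power, $n$ a positive integer, and $U$ an $\mathbb{F}_q$-subspace of dimension $k$ in $\mathbb{F}_{q^n}$ such that $U$ generates a full-length orbit. Let $\beta\in\mathbb{F}_{q^n}\setminus\mathbb{F}_q$ be such that $\mathrm{Orb}_\beta(U)$ is a sunflower with a non-trivial center (i.e. center $\neq\{0\}$). Then \[|\mathrm{Orb}_\beta(U)|\leq\frac{q^s-1}{q-1},\] where $s$ is the largest positive divisor of $n$ such that $s<k$.
   Context: For an $\mathbb{F}_q$-subspace $U$ of $\mathbb{F}_{q^n}$ and $\alpha\in\mathbb{F}_{q^n}^*$, $\alpha U=\{\alpha u\mid u\in U\}$ and $\mathrm{Stab}(U)=\{\alpha\in\mathbb{F}_{q^n}^*\mid \alpha U=U\}$. $U$ generates a full-length orbit if $\mathrm{Stab}(U)=\mathbb{F}_q^*$. For $\beta\in\mathbb{F}_{q^n}^*\setminus\{1\}$ of multiplicative order $|\beta|$, $\mathrm{Orb}_\beta(U)=\{\beta^iU\mid i=0,1,\ldots,|\beta|-1\}$. $\mathrm{Orb}_\beta(U)$ is called a sunflower if there is an $\mathbb{F}_q$-subspace $T$ of $\mathbb{F}_{q^n}$ such that $xU\cap zU=T$ for all $xU,zU\in\mathrm{Orb}_\beta(U)$ with $xU\neq zU$; $T$ is called the center. *)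

(* Defs.v *)
From HB Require Import structures.
From mathcomp Require Import all_boot all_order all_fingroup all_algebra.
From mathcomp Require Import all_solvable all_field.

Set Implicit Arguments.
Unset Strict Implicit.
Unset Printing Implicit Defensive.

Import GRing.Theory.
Local Open Scope ring_scope.

(* Here F stands for F_q and L, an extension of F of degree n, for F_{q^n};
   the subfield F_q of L is the line 1%VS spanned by 1. *)

Definition scalev (F : finFieldType) (L : fieldExtType F) (a : L)
    (U : {vspace L}) : {vspace L} :=
  (amull a @: U)%VS.

Lemma scalevP (F : finFieldType) (L : fieldExtType F) (a : L)
    (U : {vspace L}) (v : L) :
  reflect (exists2 u, u \in U & v = a * u) (v \in scalev a U).
Proof.
apply: (iffP memv_imgP) => -[u uU ->]; exists u => //; by rewrite lfunE.
Qed.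

Definition stab (F : finFieldType) (L : fieldExtType F) (U : {vspace L}) :
    pred L :=
  [pred a | (a != 0) && (scalev a U == U)].

Definition full_length_orbit (F : finFieldType) (L : fieldExtType F)
    (U : {vspace L}) : Prop :=
  stab U =i [pred a : L | (a != 0) && (a \in 1%VS)].

(* [finvect_type L] is L with its finite type structure, so that its units form
   a finite group; [insubd] sends a nonzero b to the corresponding unit (and 0
   to the unit 1). *)
Definition mulorder (F : finFieldType) (L : fieldExtType F) (b : L) : nat :=
  #[insubd (1%g : {unit (finvect_type L)}) (b : finvect_type L)]%g.

Lemma mulorder_prim (F : finFieldType) (L : fieldExtType F) (b : L) :
  b != 0 -> (mulorder b).-primitive_root b.
Proof.
move=> b0; rewrite /mulorder; set u := insubd _ _.
have valu : val u = b by rewrite /u val_insubd unitfE b0.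
have uX m : (u ^+ m == 1)%g = (b ^+ m == 1).
  by rewrite -val_eqE FinRing.val_unitX valu.
have b1 : b ^+ #[u]%g = 1 by apply/eqP; rewrite -uX expg_order.
have [m prim_m m_dv] := prim_order_exists (order_gt0 u) b1.
suffices /eqP <- : m == #[u]%g by [].
by rewrite eqn_dvd m_dv order_dvdn uX -(prim_order_dvd prim_m) dvdnn.
Qed.

(* The listed translates, without repetition; the size of this list is
   therefore the cardinality of the orbit. *)
Definition Orb (F : finFieldType) (L : fieldExtType F) (b : L)
    (U : {vspace L}) : seq {vspace L} :=
  undup [seq scalev (b ^+ i) U | i <- iota 0 (mulorder b)].

Definition sunflower_with_center (F : finFieldType) (L : fieldExtType F)
    (S : seq {vspace L}) (T : {vspace L}) : Prop :=
  forall X Z : {vspace L}, X \in S -> Z \in S -> X <> Z -> (X :&: Z)%VS = T.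

(* 0 when there is no such divisor. *)
Definition largest_divisor_below (n k : nat) : nat :=
  \max_(d <- divisors n | (d < k)%N) d.

(* Main.v *)
(** The center [T] of a nontrivial sunflower [Orb b U] is [U :&: b U], and also
    [b U :&: b^2 U], so it is stable under [b], hence under the field
    [K = F(b)].  As [T] is a nonzero proper subspace of [U], the degree of [K],
    a divisor of [n], is less than [k].  Since [U] has a full-length orbit, the
    translates [b^i U] correspond to distinct classes of [K^* / F^*]. *)
Require Import Defs.
From HB Require Import structures.
From mathcomp Require Import all_boot all_order all_fingroup all_algebra.
From mathcomp Require Import all_solvable all_field.

Set Implicit Arguments.
Unset Strict Implicit.
Unset Printing Implicit Defensive.

Import GRing.Theory.
Local Open Scope ring_scope.

Section Orbits.
Variables (F : finFieldType) (L : fieldExtType F).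
Implicit Types (U T : {vspace L}) (a b c : L).

Lemma scalevM a b U : scalev a (scalev b U) = scalev (a * b) U.
Proof.
apply/vspaceP=> v; apply/scalevP/scalevP => [[_ /scalevP[u uU ->] ->]|[u uU ->]].
  by exists u; rewrite ?mulrA.
by exists (b * u); rewrite ?mulrA //; apply/scalevP; exists u.
Qed.

Lemma scale1v U : scalev 1 U = U.
Proof.
apply/vspaceP=> v; apply/scalevP/idP => [[u uU ->]|vU]; first by rewrite mul1r.
by exists v; rewrite ?mul1r.
Qed.

Lemma scalev_inj a : a != 0 -> injective (scalev a).
Proof.
move=> a0; apply: (can_inj (g := scalev a^-1)) => U.
by rewrite scalevM mulVf ?scale1v.
Qed.

Lemma dim_scalev a U : a != 0 -> \dim (scalev a U) = \dim U.
Proof.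
move=> a0; apply: limg_dim_eq; apply/eqP; rewrite -subv0.
apply/subvP=> v; rewrite memv_cap memv_ker lfunE /= mulf_eq0 (negPf a0) /=.
by case/andP=> _ /eqP->; rewrite mem0v.
Qed.

(** Dividing by [c] turns the equality into [a / c] fixing [U], and a full-length orbit leaves only
    the nonzero elements of F as stabilizers. *)
Lemma scalev_eq a c U : full_length_orbit U -> a != 0 -> c != 0 ->
  (scalev a U == scalev c U) = (a / c \in 1%VS).
Proof.
move=> fullU a0 c0; have ac0 : a / c != 0 by rewrite mulf_neq0 ?invr_eq0.
have := fullU (a / c); rewrite !inE ac0 /= => <-.
by rewrite -[in RHS](inj_eq (scalev_inj c0)) scalevM mulrCA divff // mulr1.
Qed.

(** Exponents reduce modulo the order of [b], so [i] needs no bound. *)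
Lemma mem_Orb b U X :
  b != 0 -> reflect (exists i, X = scalev (b ^+ i) U) (X \in Orb b U).
Proof.
move=> b0; rewrite mem_undup; have prim_b := mulorder_prim b0.
apply: (iffP mapP) => [[i _ ->]|[i ->]]; first by exists i.
exists (i %% mulorder b)%N; last by rewrite prim_expr_mod.
by rewrite mem_iota /= add0n ltn_mod (prim_order_gt0 prim_b).
Qed.

(** An element of F(b) is a polynomial in [b] over F, and each of its monomials preserves [T]. *)
Lemma Fadjoin_stable b T x t :
    (forall u, u \in T -> b * u \in T) -> x \in <<1; b>>%VS -> t \in T ->
  x * t \in T.
Proof.
move=> bT /Fadjoin_polyP[p /polyOver1P[r ->] ->] tT.
rewrite horner_coef mulr_suml rpred_sum // => i _.
rewrite coef_map /= -mulrA mulr_algl rpredZ //.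
elim: (val i) => [|m IHm]; first by rewrite mul1r.
by rewrite exprS -mulrA bT.
Qed.

(** For a nonzero [t0] in [T], the line K [t0] over K = F(b) lies in [T] and has the same
    F-dimension as K. *)
Lemma dim_Fadjoin_le b T : T <> 0%VS -> (forall u, u \in T -> b * u \in T) ->
  (\dim <<1; b>>%VS <= \dim T)%N.
Proof.
move=> /eqP T0 bT; have t0 : vpick T != 0 by rewrite vpick0.
rewrite -(dim_cosetv _ t0) dimvS //; apply/prodvP=> x _ xK /vlineP[r ->].
by rewrite -scalerAr rpredZ // (Fadjoin_stable bT) // memv_pick.
Qed.

(** Write each translate [X] as [c X] times [U], with [c X] a power of [b]. Then [(X, r)] maps to
    [r *: c X], injectively from pairs of a translate and a nonzero scalar to the nonzero elements
    of F(b). *)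
Lemma size_Orb_le b U : full_length_orbit U -> b != 0 ->
  (size (Orb b U) * (#|F| - 1) <= #|F| ^ \dim <<1; b>>%VS - 1)%N.
Proof.
move=> fullU b0; set K := <<1; b>>%VS.
(* The implication makes this hold for every [X], so that [xchoose] yields a total function; outside
   the orbit the index is irrelevant. *)
have bX_ex X : exists i, (X \in Orb b U) ==> (X == scalev (b ^+ i) U).
  have [/(mem_Orb _ _ b0)[i ->]|] := boolP (X \in Orb b U).
    by exists i; rewrite eqxx.
  by exists 0%N.
pose c X : L := b ^+ xchoose (bX_ex X).
have cE X : X \in Orb b U -> scalev (c X) U = X.
  by move=> XO; have /implyP/(_ XO)/eqP/esym := xchooseP (bX_ex X).
have c0 X : c X != 0 by rewrite expf_neq0.
(* The same space, viewed in the finite type on L so that its elements can be counted. *)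
pose K' : {vspace finvect_type L} := K.
have cardF : size (enum (predC1 (0 : F))) = (#|F| - 1)%N.
  by rewrite -cardE cardC1 subn1.
have cardK :
    #|[pred x : finvect_type L | (x \in K') && (x != 0)]|
    = (#|F| ^ \dim K - 1)%N.
  rewrite -(card_vspace K') (cardD1 0 K') mem0v add1n subn1 /=.
  by apply: eq_card => x; rewrite !inE andbC.
rewrite -cardF -(size_allpairs (fun X r => r *: c X)) -cardK cardE.
apply: (@uniq_leq_size (finvect_type L)) => [|x]; last first.
  case/allpairsP=> -[X r] /= [_]; rewrite mem_enum inE => r0 ->.
  rewrite mem_enum !inE scaler_eq0 negb_or (c0 X) andbT r0 andbT.
  by rewrite rpredZ // rpredX // memv_adjoin.
apply: allpairs_uniq; rewrite ?undup_uniq ?enum_uniq //.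
move=> [X r] [Y t] /allpairsP[[X1 r1] /= [XO r10 [-> ->]]].
case/allpairsP=> -[Y1 t1] /= [YO t10 [-> ->]] /= eqXY.
rewrite !mem_enum in r10 t10.
(* Equal images force [c X1 / c Y1] to be the scalar [r1^-1 * t1], so both powers of [b] give the
   same translate of [U]. *)
have eqX1 : X1 = Y1.
  rewrite -(cE X1) // -(cE Y1) //; apply/eqP; rewrite scalev_eq //.
  suffices -> : c X1 / c Y1 = (r1^-1 * t1)%:A by rewrite rpredZ ?mem1v.
  apply: (canLR (mulfK (c0 _))); rewrite mulr_algl -scalerA -eqXY scalerA.
  by rewrite mulVf // scale1r.
subst Y1; congr (_, _); apply/eqP; rewrite -subr_eq0.
have /eqP := eqXY; rewrite -subr_eq0 -scalerBl scaler_eq0 (negPf (c0 X1)).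
by rewrite orbF.
Qed.

End Orbits.

Theorem theorem12 (q n k : nat) (F : finFieldType) (L : fieldExtType F)
    (U : {vspace L}) (b : L)
    (hq : #|F| = q) (hn : \dim {:L} = n) (hk : \dim U = k)
    (hU : full_length_orbit U)
    (hb : b \notin 1%VS)
    (hsun : exists T : {vspace L},
        sunflower_with_center (Orb b U) T /\ T <> 0%VS) :
  (size (Orb b U) <=
     (q ^ largest_divisor_below n k - 1) %/ (q - 1))%N.
Proof.
have b0 : b != 0 by apply: contraNneq hb => ->; rewrite mem0v.
have [T [sunT T0]] := hsun.
have bU_neq : U <> scalev b U.
  move=> eqU; case/negP: hb; rewrite -[b]divr1 -(scalev_eq hU) ?oner_eq0 //.
  by rewrite scale1v -eqU.
have orbU i : scalev (b ^+ i) U \in Orb b U by apply/mem_Orb => //; exists i.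
have TE : (U :&: scalev b U)%VS = T.
  apply: sunT (orbU 1%N) bU_neq.
  by have := orbU 0%N; rewrite expr0 scale1v.
(* The translates by [b] and [b ^+ 2] differ because [U] and [scalev b U] do, so they meet in the
   same center. *)
have bTE : (scalev b U :&: scalev b (scalev b U))%VS = T.
  apply: sunT; first exact: (orbU 1%N).
    by rewrite scalevM (orbU 2%N).
  by move/(scalev_inj b0).
have bT u : u \in T -> b * u \in T.
  rewrite -{1}TE -bTE !memv_cap => /andP[uU ubU].
  by apply/andP; split; apply/scalevP; exists u.
(* Otherwise [T] is all of [U], so [U] lies in [scalev b U]; equal dimensions then make them
   coincide. *)
have ltTk : (\dim T < k)%N.
  have sTU : (T <= U)%VS by rewrite -TE capvSl.
  rewrite -hk ltnNge; apply/negP => leUT; apply: bU_neq; apply/eqP.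
  rewrite eqEdim dim_scalev // leqnn andbT.
  have /eqP eqTU : T == U by rewrite eqEdim sTU.
  by rewrite -{1}eqTU -TE capvSr.
have ltKk := leq_ltn_trans (dim_Fadjoin_le T0 bT) ltTk.
have dvKn : \dim <<1; b>>%VS \in divisors n.
  rewrite -hn -dvdn_divisors ?adim_gt0 //.
  exact/field_dimS/subvf.
have leKs : (\dim <<1; b>>%VS <= largest_divisor_below n k)%N.
  exact: leq_bigmax_seq.
have q1 : (1 < q)%N by rewrite -hq finNzRing_gt1.
(* As q > 1, the bound by the floor quotient amounts to the inequality multiplied by q - 1, where
   the degree of F(b) may be raised to s. *)
rewrite leq_divRL ?subn_gt0 // -hq (leq_trans (size_Orb_le hU b0)) //.
by rewrite leq_sub2r // hq leq_pexp2l // ltnW.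
Qed.
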